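(* Let $K$ be a number field with ring of integers $\mathcal{O}_K$, and let $r$ be the rank of the unit group $\mathcal{O}_K^*$. There exist constants $b_K>0$ and $B_K>0$, depending only on $K$, such that for every real $H\ge 2$ and every $A\subseteq\{\alpha\in\mathcal{O}_K: H(\alpha)\le H\}$ there exists a subset $A'\subseteq A$ with $$|A'|\ge b_K\frac{|A|}{(\log H)^r}$$ such that for every $\alpha,\beta\in A'$, $$H(\alpha+\beta)\le B_K\,(H(\alpha)+H(\beta)),$$ where $H(\cdot)$ is the multiplicative height on $K$.
   Context: For a number field $K$, let $M_K$ be its set of places. For an Archimedean place $v$ associated with an embedding $\sigma:K\to\mathbb{C}$, $|\alpha|_v=|\sigma(\alpha)|$ (usual absolute value). For a non-Archimedean place $v$ associated with a prime ideal $\mathfrak{p}$ above the rational prime $p$, $|\alpha|_v=p^{-v_{\mathfrak{p}}(\alpha)/e_{\mathfrak{p}}}$, where $v_{\mathfrak{p}}(\alpha)$ is the exponent of $\mathfrak{p}$ in the factorization of $\alpha\mathcal{O}_K$ and $e_{\mathfrak{p}}$ is the ramification index (and $|0|_v=0$). Put $n_v=[K_v:\mathbb{Q}_v]$. The multiplicative height of $\alpha\in K$ (relative to $K$, not normalized by the degree) is $H(\alpha)=\prod_{v\in M_K}\max(1,|\alpha|_v^{n_v})$. If $r=0$, $(\log H)^r$ is $1$. *)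

(* Defs.v *)
From HB Require Import structures.
From mathcomp Require Import all_boot all_order all_algebra all_field.
From mathcomp Require Import complex.
From mathcomp Require Import all_classical all_reals all_analysis.
Import Order.TTheory GRing.Theory Num.Theory.
Import ComplexField.Normc.

Set Implicit Arguments.
Unset Strict Implicit.
Unset Printing Implicit Defensive.

Local Open Scope classical_set_scope.
Local Open Scope ring_scope.

(* The greatest element of S, and 0 if there is none. *)
Definition max_nat (S : set nat) : nat :=
  xget 0%N [set d | S d /\ forall e, S e -> (e <= d)%N].

(* A number field is a finite extension K : fieldExtType rat; its ring of
   integers, ideals, etc. are subsets of K. *)
Section RingOfIntegers.
Variable K : fieldExtType rat.

Definition OK : set K := [set x | integralOver (intr : int -> K) x].

Definition OK_unit : set K := [set x | [/\ x != 0, OK x & OK x^-1]].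

Definition mul_independent d (u : 'I_d -> K) : Prop :=
  forall e : 'I_d -> int, \prod_i u i ^ e i = 1 -> forall i, e i = 0.

(* Rank of the abelian group OK_unit: maximal number of Z-independent
   elements. *)
Definition unit_rank : nat :=
  max_nat [set d | exists u : 'I_d -> K,
    (forall i, OK_unit (u i)) /\ mul_independent u].

Definition OK_ideal (I : set K) : Prop :=
  [/\ I `<=` OK, I 0, (forall x y, I x -> I y -> I (x + y))
    & (forall a x, OK a -> I x -> I (a * x))].

(* Nonzero prime ideals. *)
Definition OK_prime (P : set K) : Prop :=
  [/\ OK_ideal P, (exists2 x, P x & x != 0), ~ P 1
    & (forall x y, OK x -> OK y -> P (x * y) -> P x \/ P y)].

Definition ideal_mul (I J : set K) : set K :=
  [set x | exists n (a b : 'I_n -> K),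
    (forall i, I (a i) /\ J (b i)) /\ x = \sum_i a i * b i].

Definition ideal_prod (s : seq (set K)) : set K := foldr ideal_mul OK s.

(* alpha OK = (product of s) / (product of t) in lowest terms, primes being
   repeated according to multiplicity; the division is written multiplicatively
   to stay within integral ideals when alpha is not an integer. *)
Definition factorization (alpha : K) (s t : seq (set K)) : Prop :=
  [/\ (forall P, P \in s -> OK_prime P),
      (forall P, P \in t -> OK_prime P),
      (forall P, P \in s -> P \notin t)
    & [set alpha * x | x in ideal_prod t] = ideal_prod s].

(* Exponent of the prime P in the factorization of alpha OK, alpha != 0. *)
Definition pval (P : set K) (alpha : K) : int :=
  xget 0 [set n : int | exists s t, factorization alpha s t /\
    n = (count_mem P s)%:Z - (count_mem P t)%:Z].

(* Ramification index of a prime P above the rational prime p. *)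
Definition ramification (P : set K) (p : nat) : int := pval P p%:R.

End RingOfIntegers.

Section Height.
Variables (R : realType) (K : fieldExtType rat).

(* A place is represented by its normalized absolute value, so that conjugate
   embeddings give one and the same place. *)
Definition arch_place (v : K -> R) : Prop :=
  exists sigma : {rmorphism K -> R[i]}, v = fun alpha => normc (sigma alpha).

Definition padic_abs (P : set K) (p : nat) (alpha : K) : R :=
  if alpha == 0 then 0
  else p%:R `^ (- ((pval P alpha)%:~R / (ramification P p)%:~R)).

Definition nonarch_place (v : K -> R) : Prop :=
  exists (P : set K) (p : nat),
    [/\ OK_prime P, prime p, P p%:R & v = padic_abs P p].

Definition places : set (K -> R) :=
  [set v | arch_place v \/ nonarch_place v].

Definition v_cauchy (v : K -> R) (x : nat -> K) : Prop :=
  forall e : R, 0 < e -> exists N, forall m n,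
    (N <= m)%N -> (N <= n)%N -> v (x m - x n) < e.

Definition v_null (v : K -> R) (x : nat -> K) : Prop :=
  forall e : R, 0 < e -> exists N, forall n, (N <= n)%N -> v (x n) < e.

(* K_v is the ring of v-Cauchy sequences of K modulo the v-null ones, and Q_v
   is its subfield of classes of sequences of rationals.  completion_free v d:
   K_v contains d elements that are linearly independent over Q_v. *)
Definition completion_free (v : K -> R) (d : nat) : Prop :=
  exists x : 'I_d -> nat -> K, (forall i, v_cauchy v (x i)) /\
    forall c : 'I_d -> nat -> rat,
      (forall i, v_cauchy v (fun n => (c i n)%:A)) ->
      v_null v (fun n => \sum_i c i n *: x i n) ->
      forall i, v_null v (fun n => (c i n)%:A).

(* n_v = [K_v : Q_v] *)
Definition local_degree (v : K -> R) : nat :=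
  max_nat [set d | completion_free v d].

(* The product is finitely supported: all but finitely many factors are 1. *)
Definition height (alpha : K) : R :=
  \big[*%R/1]_(v \in places) Num.max 1 (v alpha ^+ local_degree v).

End Height.

(* Main.v *)
From HB Require Import structures.
Require Import Defs.
From mathcomp Require Import all_boot all_order all_algebra all_field.
From mathcomp Require Import complex zify ring lra.
From mathcomp Require Import all_classical all_reals all_analysis.
Import Order.TTheory GRing.Theory Num.Theory.
Import ComplexField.Normc.

(* Integral elements have height the product, over the archimedean places, of
   the factors max (1, v(alpha) ^ n_v); the values of the n_v play no role.
   Let w be one of these places and t the list of the others.  Cut A according
   to the integer parts of the logarithms of the factors at the places in t,
   which lie in [0, log H].  In a cell these factors agree up to e, hence
   H(alpha + beta) is at most a constant times the larger of H(alpha) and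
   H(beta), and A' can be the most populated cell.  There are O((log H) ^ |t|)
   cells, and |t| <= r is the hard half of Dirichlet's unit theorem; since r
   is defined as a maximum, its easy half is needed as well.  The pigeonhole
   principle for linear forms gives, for each place k, infinitely many integral
   elements of bounded norm that are smaller and smaller outside k; two of them
   are associates, and their quotient is a unit dominant at k.  Any |t| of
   these units are independent, by diagonal dominance of their logarithms. *)

Set Implicit Arguments.
Unset Strict Implicit.
Unset Printing Implicit Defensive.

Local Open Scope classical_set_scope.
Local Open Scope ring_scope.

(** * Integers *)

Section IntegersTheory.
Variable K : fieldExtType rat.
Implicit Types x y : K.

Lemma OK_int (z : int) : OK (z%:~R : K).
Proof. exact: integral_id. Qed.

Lemma OK0 : @OK K 0.
Proof. exact: (OK_int 0). Qed.

Lemma OK1 : @OK K 1.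
Proof. exact: (OK_int 1). Qed.

Lemma OKD x y : OK x -> OK y -> OK (x + y).
Proof. exact: integral_add. Qed.

Lemma OKB x y : OK x -> OK y -> OK (x - y).
Proof. exact: integral_sub. Qed.

Lemma OKM x y : OK x -> OK y -> OK (x * y).
Proof. exact: integral_mul. Qed.

Lemma OKX x m : OK x -> OK (x ^+ m).
Proof.
move=> Ox; elim: m => [|m IH]; first exact: OK1.
by rewrite exprS; exact: OKM.
Qed.

Lemma OK_sum (I : finType) (F : I -> K) : (forall i, OK (F i)) -> OK (\sum_i F i).
Proof. by move=> OF; elim/big_ind: _ => //; [exact: OK0 | exact: OKD]. Qed.

Lemma OK_unit1 : @OK_unit K 1.
Proof. by split; rewrite ?oner_neq0 ?invr1 //; exact: OK1. Qed.

Lemma OK_unitM x y : OK_unit x -> OK_unit y -> OK_unit (x * y).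
Proof.
by move=> [x0 Ox Ox'] [y0 Oy Oy']; split; rewrite ?mulf_neq0 ?invfM //; exact: OKM.
Qed.

Lemma OK_unitV x : OK_unit x -> OK_unit x^-1.
Proof. by move=> [x0 Ox Ox']; split; rewrite ?invr_eq0 ?invrK. Qed.

Lemma OK_unitXz x (z : int) : OK_unit x -> OK_unit (x ^ z).
Proof.
move=> ux; have uX n : OK_unit (x ^+ n).
  elim: n => [|n IH]; first exact: OK_unit1.
  by rewrite exprS; exact: OK_unitM.
by case: z => n; [exact: uX | exact: (OK_unitV (uX n.+1))].
Qed.

Lemma OK_unit_prod (I : finType) (F : I -> K) :
  (forall i, OK_unit (F i)) -> OK_unit (\prod_i F i).
Proof. by move=> uF; elim/big_ind: _ => //; [exact: OK_unit1 | exact: OK_unitM]. Qed.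

Lemma intr_alg (z : int) : z%:~R = (z%:~R : rat)%:A :> K.
Proof. by rewrite -in_algE rmorph_int. Qed.

Lemma intr_alg_inj : injective (intr : int -> K).
Proof. by move=> y z; rewrite !intr_alg -!in_algE => /fmorph_inj/intr_inj. Qed.

Lemma intr_alg_eq0 (z : int) : (z%:~R == 0 :> K) = (z == 0).
Proof. by rewrite -(inj_eq intr_alg_inj). Qed.

(* If p is integral with leading coefficient a and p(x) = 0, then a x is
   integral: multiply p(x) = 0 by a ^ (deg p - 1). *)
Lemma OK_multiple x : exists2 a : int, a != 0 & OK (a%:~R * x).
Proof.
have /polyOver1P[q Dq] := minPolyOver 1 x.
have [p [a a0 Dp]] := rat_poly_scale q.
have q0 : q != 0.
  by rewrite -(map_poly_eq0 (in_alg K)) -Dq monic_neq0 // monic_minPoly.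
have p0 : p != 0 by apply: contraNneq q0 => p0; rewrite Dp p0 rmorph0 scaler0.
have px : root (map_poly intr p) x.
  have : root (map_poly (in_alg K) q) x by rewrite -Dq root_minPoly.
  rewrite Dp linearZ /= rootZ; last first.
    by rewrite scaler_eq0 oner_eq0 orbF invr_eq0 intr_eq0.
  rewrite -map_poly_comp (_ : map_poly _ p = map_poly intr p) //.
  by apply: eq_map_poly => z; exact: (rmorph_int (in_alg K)).
pose c := lead_coef p; have c0 : c != 0 by rewrite lead_coef_eq0.
exists c => //.
have sz : (1 < size p)%N.
  rewrite ltnNge; apply/negP => /size1_polyC Ep.
  move: px; rewrite Ep map_polyC rootC /= intr_alg_eq0 => /eqP pp0.
  by move: p0; rewrite Ep pp0 polyC0 eqxx.
set m := (size p).-2.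
have szE : size p = m.+2 by rewrite /m; case: (size p) sz => [|[]].
pose r : {poly int} := 'X^(m.+1) + \poly_(i < m.+1) (p`_i * c ^+ (m - i)).
exists r.
  rewrite monicE lead_coefDl ?lead_coefXn // size_polyXn ltnS.
  exact: size_poly.
rewrite /r rmorphD /= map_polyXn rootE hornerD hornerXn.
rewrite poly_def rmorph_sum horner_sum /=.
move: px; rewrite rootE horner_coef size_map_inj_poly ?mulr0z//; last exact: intr_alg_inj.
rewrite szE big_ord_recr /= coef_map /=.
have -> : p`_m.+1 = c by rewrite /c lead_coefE szE.
move=> /eqP H.
have : c%:~R ^+ m * (\sum_(i < m.+1) (map_poly intr p)`_i * x ^+ i + c%:~R * x ^+ m.+1) = 0.
  by rewrite H mulr0.
rewrite mulrDr mulrA -exprSr -exprMn addrC => E; apply/eqP; rewrite -[RHS]E; congr (_ + _).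
rewrite mulr_sumr; apply: eq_bigr => i _.
rewrite linearZ /= map_polyXn hornerZ hornerXn coef_map /= exprMn rmorphM rmorphXn /=.
rewrite [RHS]mulrCA -mulrA; congr (_ * _); rewrite mulrA -exprD subnK //.
by rewrite -ltnS.
Qed.

(** Rational root theorem: [f] is injective, so the monic equation already holds in [rat], and a
    rational algebraic integer in [algC] is an integer. *)
Lemma ratr_integral_int (F : fieldType) (f : {rmorphism rat -> F}) (q : rat) :
  integralOver (intr : int -> F) (f q) -> exists z : int, q = z%:~R.
Proof.
move=> [p pm]; have -> : map_poly (intr : int -> F) p = map_poly f (map_poly intr p).
  by rewrite -map_poly_comp; apply: eq_map_poly => z /=; rewrite rmorph_int.
rewrite fmorph_root => rq.
have : (ratr q : algC) \in Num.int.
  apply: Cint_rat_Aint; first exact: Crat_rat.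
  apply: (@root_monic_Aint (map_poly ratr (map_poly intr p))).
  - by rewrite fmorph_root.
  - by rewrite map_monic; exact: monic_map.
  - apply/polyOverP => i; rewrite !coef_map /= rmorph_int; exact: intr_int.
move=> /intrP[z Hz]; exists z; apply: (fmorph_inj (ratr : {rmorphism rat -> algC})).
by rewrite /= Hz rmorph_int.
Qed.

End IntegersTheory.

(** * Embeddings *)

Section Embeddings.
Variables (K : fieldExtType rat) (L : numClosedFieldType).
Implicit Types (x : K) (p : {poly rat}).

Local Notation "p ^K" := (map_poly (in_alg K) p) (at level 2, format "p ^K").
Local Notation "p ^L" := (map_poly (ratr : rat -> L) p) (at level 2, format "p ^L").

Lemma rmorph_horner_alg (s : {rmorphism K -> L}) p x : s p^K.[x] = p^L.[s x].
Proof.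
rewrite -horner_map -map_poly_comp; congr (_.[_]); apply: eq_map_poly => a /=.
exact: (fmorph_eq_rat (s \o in_alg K)).
Qed.

(** Since K = Q[x], sending p(x) to p(z) defines the embedding; the second hypothesis makes it
    independent of the choice of p. *)
Lemma embedding_of_root x (z : L) :
  <<1; x>>%VS = fullv ->
  (forall p, p^K.[x] = 0 -> p^L.[z] = 0) ->
  exists s : {rmorphism K -> L}, s x = z.
Proof.
move=> xK zP; have gen y : exists p, y = p^K.[x].
  by apply/Fadjoin1_polyP; rewrite xK memvf.
pose f y : L := (sval (cid (gen y)))^L.[z].
have fE p : f p^K.[x] = p^L.[z].
  rewrite /f; case: cid => p' /= Ep; apply/eqP; rewrite -subr_eq0 -hornerN -hornerD.
  by rewrite -rmorphB; apply/eqP/zP; rewrite rmorphB hornerD hornerN -Ep subrr.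
have fB : zmod_morphism f.
  move=> a b; have [p ->] := gen a; have [q ->] := gen b.
  by rewrite -hornerN -hornerD -rmorphB !fE rmorphB hornerD hornerN.
have fM : monoid_morphism f.
  split; first by have := fE 1; rewrite !rmorph1 !hornerE.
  move=> a b; have [p ->] := gen a; have [q ->] := gen b.
  by rewrite -hornerM -rmorphM !fE rmorphM hornerM.
pose fa := GRing.isZmodMorphism.Build K L f fB.
pose fm := GRing.isMonoidMorphism.Build K L f fM.
pose F : {rmorphism K -> L} := HB.pack f fa fm.
exists F => /=.
by have := fE 'X; rewrite !map_polyX !hornerX.
Qed.

(* x is an integral primitive element of K, encoded by its power basis. *)
Definition embedding_system n (s : 'I_n -> {rmorphism K -> L}) x : Prop :=
  [/\ OK x, injective (fun i => s i x),
      forall t : {rmorphism K -> L}, exists i, t =1 s i,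
      forall y, exists c : 'I_n -> rat, y = \sum_i c i *: x ^+ i
    & forall c : 'I_n -> rat, \sum_i c i *: x ^+ i = 0 -> forall i, c i = 0].

Lemma pchar_numfield : [pchar K] =i pred0.
Proof.
move=> p; rewrite !inE; apply/negP => /andP[pp].
by rewrite -[p%:R]/(p%:Z%:~R) intr_alg_eq0 eqz_nat => /eqP p0; rewrite p0 in pp.
Qed.

(** A separable generator still generates after multiplication by a nonzero integer that makes it
    integral. *)
Lemma integral_primitive_element : exists2 x : K, OK x & <<1; x>>%VS = fullv.
Proof.
have sepK : separable 1%AS {:K}%AS.
  by apply/separableP => y _; exact: pcharf0_separable pchar_numfield _.
have := eq_adjoin_separable_generator sepK (sub1v _).
set x := separable_generator _ _ => xK.
have [a a0 Ox] := OK_multiple x; exists (a%:~R * x) => //.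
apply/eqP; rewrite eqEsubv subvf /= [in X in (X <= _)%VS]xK.
apply/FadjoinP; split; first exact: subv_adjoin.
have {1}-> : x = (a%:~R^-1 : rat) *: (a%:~R * x).
  by rewrite intr_alg -scalerAl mul1r scalerK // intr_eq0.
by rewrite rpredZ // memv_adjoin.
Qed.

(** There is one embedding per root in [L] of the minimal polynomial [q] of an integral generator;
    division by [q] gives the power basis. *)
Lemma embedding_system_exists :
  exists n (s : 'I_n.+1 -> {rmorphism K -> L}) x, embedding_system s x.
Proof.
have [x Ox xK] := integral_primitive_element.
have gen y : exists p, y = p^K.[x].
  by apply/Fadjoin1_polyP; rewrite xK memvf.
have /polyOver1P[q Dq] := minPolyOver 1%AS x.
have qx p : (p^K.[x] == 0) = (q %| p).
  apply/idP/idP => [px|/dvdpP[r ->]].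
    have : q^K %| p^K by rewrite -Dq minPoly_dvdp // alg_polyOver.
    by rewrite dvdp_map.
  by rewrite rmorphM hornerM /= -Dq minPolyxx mulr0.
have qm : q \is monic by rewrite -(map_monic (in_alg K)) -Dq monic_minPoly.
have szq : size q = (adjoin_degree 1%AS x).+1.
  by rewrite -(size_map_poly (in_alg K)) -Dq size_minPoly.
(* [adjoin_degree] is a successor by definition. *)
have [n Dn] : exists n, adjoin_degree 1%AS x = n.+1 by eexists; reflexivity.
rewrite Dn in szq.
have [rs Drs] := closed_field_poly_normal q^L.
rewrite lead_coef_map (monicP qm) rmorph1 scale1r in Drs.
have szrs : size rs = n.+1.
  apply: succn_inj; rewrite -szq -(size_map_poly (ratr : {rmorphism rat -> L})).
  by rewrite Drs size_prod_XsubC.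
have urs : uniq rs.
  rewrite -separable_prod_XsubC -Drs separable_map -(separable_map (in_alg K)) -Dq.
  exact: pcharf0_separable pchar_numfield _.
have /choice[s sx] (i : 'I_n.+1) : exists s : {rmorphism K -> L}, s x = rs`_i.
  apply: embedding_of_root xK _ => p /eqP; rewrite qx => /dvdpP[r ->].
  rewrite rmorphM hornerM /= Drs; apply/eqP; rewrite mulf_eq0; apply/orP; right.
  by rewrite -rootE root_prod_XsubC mem_nth // szrs.
exists n, s, x; split => //.
- by move=> i j /eqP; rewrite !sx nth_uniq ?szrs // => /eqP/val_inj.
- move=> t; have tx : t x \in rs.
    rewrite -root_prod_XsubC -Drs rootE -rmorph_horner_alg.
    by rewrite -Dq minPolyxx rmorph0.
  have ti : (index (t x) rs < n.+1)%N by rewrite -szrs index_mem.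
  exists (Ordinal ti) => y; have [p ->] := gen y.
  by rewrite !rmorph_horner_alg sx nth_index.
- move=> y; have [p ->] := gen y; exists (fun i => (p %% q)`_i).
  rewrite {1}(divp_eq p q) rmorphD rmorphM hornerD hornerM /= -Dq minPolyxx mulr0 add0r.
  rewrite (@horner_coef_wide _ n.+1).
    by apply: eq_bigr => i _; rewrite coef_map /= mulr_algl.
  by rewrite size_map_poly -ltnS -szq ltn_modp monic_neq0.
(* A relation gives a polynomial of size at most n + 1 divisible by [q], which has size n + 2: it is
   0. *)
- move=> c c0 i; pose p := \poly_(i < n.+1) (if insub i is Some j then c j else 0).
  have pc (j : 'I_n.+1) : p`_j = c j by rewrite coef_poly ltn_ord valK.
  have : q %| p.
    rewrite -qx -c0 (@horner_coef_wide _ n.+1) ?size_map_poly ?size_poly //.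
    by apply/eqP; apply: eq_bigr => j _; rewrite coef_map pc /= mulr_algl.
  rewrite -pc; have [->|p0 /(dvdp_leq p0)] := eqVneq p 0; first by rewrite coef0.
  by rewrite szq leqNgt ltnS size_poly.
Qed.

End Embeddings.

(** * Norms as products of conjugates *)

Section Norm.
Variables (K : fieldExtType rat) (L : numClosedFieldType).

(** By injectivity of [t], both elements satisfy the same monic integral equations; integrality in
    [K] can thus be checked in [L]. *)
Lemma integral_embedding (t : {rmorphism K -> L}) (y : K) :
  integralOver (intr : int -> L) (t y) <-> OK y.
Proof.
have tE p : map_poly (intr : int -> L) p = map_poly t (map_poly intr p).
  by rewrite -map_poly_comp; apply: eq_map_poly => z /=; rewrite rmorph_int.
by split=> -[p pm rp]; exists p => //; move: rp; rewrite tE fmorph_root.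
Qed.

Variables (n : nat) (s : 'I_n.+1 -> {rmorphism K -> L}) (x : K).
Hypothesis sx : embedding_system s x.

(* The matrix of multiplication by y in the power basis of x is conjugate, by
   the Vandermonde matrix of the conjugates of x, to diag (s i y). *)
Lemma norm_rational y : exists q : rat, ratr q = \prod_i s i y.
Proof.
have [_ inj _ gen _] := sx.
have sZ i (a : rat) b : s i (a *: b) = ratr a * s i b.
  by rewrite -mulr_algl rmorphM; congr (_ * _); exact: (fmorph_eq_rat (s i \o in_alg K)).
have /choice[M ME] (i : 'I_n.+1) := gen (y * x ^+ i).
pose A : 'M[rat]_n.+1 := \matrix_(i, j) M i j.
pose a : 'rV[L]_n.+1 := \row_i s i x.
pose V := Vandermonde n.+1 a.
have AV : map_mx ratr A *m V = V *m diag_mx (\row_i s i y).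
  apply/matrixP => i j; rewrite !mxE [RHS](bigD1 j) //= [in RHS]big1 => [|k kj]; last first.
    by rewrite !mxE (negbTE kj) mulr0n mulr0.
  rewrite addr0 !mxE eqxx mulr1n -rmorphXn -rmorphM /= [_ * y]mulrC ME rmorph_sum.
  by apply: eq_bigr => k _; rewrite !mxE sZ rmorphXn.
have V0 : \det V != 0.
  rewrite det_Vandermonde; apply/prodf_neq0 => i _; apply/prodf_neq0 => j ij.
  by rewrite !mxE subr_eq0; apply: contraTneq ij => /inj ->; rewrite ltnn.
exists (\det A); apply: (mulIf V0).
rewrite -det_map_mx /= -det_mulmx AV det_mulmx det_diag mulrC.
by congr (_ * _); apply: eq_bigr => i _; rewrite mxE.
Qed.

Lemma norm_int y : OK y -> exists z : int, z%:~R = \prod_i s i y.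
Proof.
move=> Oy; have [q qE] := norm_rational y.
have : integralOver (intr : int -> L) (ratr q).
  rewrite qE; elim/big_ind: _ => [|a b|i _]; last exact/integral_embedding.
    exact: integral1.
  exact: integral_mul.
move=> /(ratr_integral_int (f := ratr)) [z qz].
by exists z; rewrite -qE qz rmorph_int.
Qed.

(** Under [s ord0], the quotient of the norm by [y] becomes the product of the other conjugates. *)
Lemma norm_divisible y (z : int) :
  OK y -> z%:~R = \prod_i s i y -> OK (z%:~R / y).
Proof.
move=> Oy zE; have [->|y0] := eqVneq y 0; first by rewrite invr0 mulr0; exact: OK0.
apply/(integral_embedding (s ord0)).
rewrite fmorph_div rmorph_int zE (bigD1 ord0) //= mulrAC mulfV ?fmorph_eq0 // mul1r.
elim/big_ind: _ => [|a b|i _]; last exact/integral_embedding.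
  exact: integral1.
exact: integral_mul.
Qed.

End Norm.

(** * Pigeonhole principle for linear forms *)

Section Pigeonhole.
Variable R : realType.

(** Dirichlet's box principle: two vectors with coordinates in [0, P] whose values under all the
    forms fall in the same box have the required difference. *)
Lemma pigeonhole_linear_forms (T : finType) d (l : T -> 'I_d -> R) (C M : nat) :
  (#|T| < d)%N -> (0 < M)%N -> (forall t j, `|l t j| <= C%:R) ->
  exists e : 'I_d -> int,
    [/\ exists j, e j != 0, forall j, (`|e j| <= M ^ #|T|)%N
      & forall t, `|\sum_j (e j)%:~R * l t j|
                  <= (2 * d * C).+1%:R / M%:R ^+ (d - #|T|)].
Proof.
move=> Td M0 lC; set P := (M ^ #|T|)%N; pose Q := (M ^ (d - #|T|))%N.
set c : R := _.+1%:R; have c0 : 0 < c by rewrite ltr0n.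
have PQ : (P * Q = M ^ d)%N by rewrite -expnD subnKC // ltnW.
have P0 : (0 < P)%N by rewrite expn_gt0 M0.
have Q0 : (0 < Q)%N by rewrite expn_gt0 M0.
(* The shift makes the values nonnegative, so that [Num.truncn] is their integer part. *)
pose y (a : {ffun 'I_d -> 'I_P.+1}) t : R := \sum_j (a j)%:R * l t j + (d * C * P)%:R.
have ly (a : {ffun 'I_d -> 'I_P.+1}) t : `|\sum_j (a j)%:R * l t j| <= (d * C * P)%:R.
  apply: le_trans (ler_norm_sum _ _ _) _.
  have -> : (d * C * P)%:R = \sum_(j < d) (P * C)%:R :> R.
    by rewrite sumr_const card_ord -[RHS]mulr_natr -natrM; congr _%:R; lia.
  apply: ler_sum => j _; rewrite normrM natrM; apply: ler_pM => //.
  by rewrite normr_nat ler_nat -ltnS; exact: ltn_ord (a j).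
have y0 a t : 0 <= y a t.
  by have := ly a t; rewrite ler_norml -subr_ge0 opprK => /andP[].
have yM a t : y a t <= (2 * d * C * P)%:R.
  have := ly a t; rewrite ler_norml => /andP[_ H].
  by rewrite /y -!mulnA mul2n -addnn natrD lerD2r !mulnA.
(* Boxes have width c / Q; as c exceeds 2 d C, the values stay strictly below the end of the last
   box. *)
have bnd a t : (Num.truncn (y a t * Q%:R / c) < (P * Q).-1.+1)%N.
  rewrite prednK ?muln_gt0 ?P0 // truncn_lt_nat; last first.
    by rewrite divr_ge0 ?mulr_ge0 ?ler0n // ltW.
  rewrite ltr_pdivrMr // natrM -mulrA [Q%:R * c]mulrC mulrA ltr_pM2r ?ltr0n //.
  apply: le_lt_trans (yM a t) _; by rewrite -natrM ltr_nat mulnC ltn_pmul2l.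
pose f a : {ffun T -> 'I_(P * Q).-1.+1} := [ffun t => Ordinal (bnd a t)].
(* There are (P + 1) ^ d vectors for (P Q) ^ #|T| = P ^ d boxes. *)
have /injectivePn[a [b ab fab]] : ~~ injectiveb f.
  apply/negP => /injectiveP/leq_card; rewrite !card_ffun !card_ord.
  rewrite prednK ?muln_gt0 ?P0 // PQ -expnM mulnC expnM -/P leqNgt.
  by rewrite ltn_exp2r ?ltnSn // (leq_ltn_trans _ Td).
exists (fun j => (a j)%:Z - (b j)%:Z); split.
- have /existsP[j jab] : [exists j, a j != b j].
    rewrite -negb_forall; apply: contra ab => /forallP H.
    by apply/eqP/ffunP => j; exact/eqP.
  by exists j; rewrite subr_eq0 eqz_nat.
- move=> j; have := ltn_ord (a j); have := ltn_ord (b j); rewrite !ltnS.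
  by lia.
- move=> t; have -> : \sum_j ((a j)%:Z - (b j)%:Z)%:~R * l t j = y a t - y b t.
    rewrite /y opprD addrACA subrr addr0 -sumrB; apply: eq_bigr => j _.
    by rewrite rmorphB mulrBl.
  have := congr1 (fun g : {ffun T -> 'I_(P * Q).-1.+1} => nat_of_ord (g t)) fab.
  rewrite !ffunE /=.
  set u := y a t * _ / c; set v := y b t * _ / c => uv.
  have /andP[u1 u2] : (Num.truncn u)%:R <= u < (Num.truncn u).+1%:R.
    by apply: truncn_itv; rewrite divr_ge0 ?mulr_ge0 ?ler0n // ltW.
  have /andP[v1 v2] : (Num.truncn v)%:R <= v < (Num.truncn v).+1%:R.
    by apply: truncn_itv; rewrite divr_ge0 ?mulr_ge0 ?ler0n // ltW.
  have -> : y a t - y b t = (u - v) * (c / M%:R ^+ (d - #|T|)).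
    rewrite /u /v -mulrBl -mulrBl -natrX -/Q mulrA mulfVK ?gt_eqF //.
    by rewrite mulfK // pnatr_eq0 -lt0n.
  have cM : 0 <= c / M%:R ^+ (d - #|T|) by rewrite divr_ge0 ?exprn_ge0 ?ler0n.
  rewrite normrM [X in _ * X]ger0_norm // ler_piMl //.
  by move: v1 v2; rewrite -uv => v1 v2; rewrite ler_norml; lra.
Qed.

End Pigeonhole.

(** * Finiteness of integers with bounded conjugates *)

Section NormcTheory.
Variable R : realType.
Implicit Types z w : R[i].

Lemma normc_complex z : (normc z)%:C%C = `|z|.
Proof. by case: z. Qed.

Lemma normc_ge0 z : 0 <= normc z.
Proof. by case: z => a b; exact: sqrtr_ge0. Qed.

Lemma normc_eq0 z : (normc z == 0) = (z == 0).
Proof. by apply/eqP/eqP => [/eq0_normc|->] //; exact: normc0. Qed.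

Lemma normc_gt0 z : (0 < normc z) = (z != 0).
Proof. by rewrite lt0r normc_eq0 normc_ge0 andbT. Qed.

Lemma normcD z w : normc (z + w) <= normc z + normc w.
Proof. exact: le_normcD. Qed.

Lemma normcB z w : normc (z - w) <= normc z + normc w.
Proof. by rewrite -[X in _ <= _ + X]normcN normcD. Qed.

Lemma normc_prod (I : finType) (P : pred I) (F : I -> R[i]) :
  normc (\prod_(i | P i) F i) = \prod_(i | P i) normc (F i).
Proof. exact: (big_morph (@normc R) (@normcM R) (@normc1 R)). Qed.

Lemma normc_int (m : int) : normc (m%:~R : R[i]) = `|m|%:~R.
Proof.
by apply: complexI; rewrite normc_complex rmorph_int intr_norm.
Qed.

Lemma normc_nat (m : nat) : normc (m%:R : R[i]) = m%:R.
Proof. by have := normc_int m%:Z. Qed.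

Lemma normc_ReIm z : normc z <= `|complex.Re z| + `|complex.Im z|.
Proof.
case: z => a b /=; rewrite -[leRHS]ger0_norm ?addr_ge0 // -sqrtr_sqr ler_wsqrtr //.
rewrite sqrrD !real_normK ?num_real //.
by have := mulr_ge0 (normr_ge0 a) (normr_ge0 b); lra.
Qed.

Lemma Re_le_normc z : `|complex.Re z| <= normc z.
Proof. by case: z => a b /=; rewrite -sqrtr_sqr ler_wsqrtr // lerDl sqr_ge0. Qed.

Lemma Im_le_normc z : `|complex.Im z| <= normc z.
Proof. by case: z => a b /=; rewrite -sqrtr_sqr ler_wsqrtr // lerDr sqr_ge0. Qed.

Lemma normc_conj z : normc (conjc z) = normc z.
Proof. by case: z => a b /=; rewrite sqrrN. Qed.

End NormcTheory.

Section Northcott.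
Variables (R : realType) (K : fieldExtType rat) (n : nat).
Variables (s : 'I_n.+1 -> {rmorphism K -> R[i]}) (x : K).
Hypothesis sx : embedding_system s x.

Lemma norm_nat (y : K) : OK y -> y != 0 ->
  exists m : nat, [/\ (0 < m)%N, m%:R = \prod_i normc (s i y) & OK (m%:R / y)].
Proof.
move=> Oy y0; have [z zE] := norm_int sx Oy; exists `|z|%N; split.
- rewrite absz_gt0 -(intr_eq0 R[i]) zE; apply/prodf_neq0 => i _.
  by rewrite fmorph_eq0.
- by rewrite -normc_prod -zE normc_int pmulrn abszE.
- have Oz := norm_divisible Oy zE; rewrite pmulrn abszE.
  case: (leP 0 z) => z0; first by rewrite ger0_norm.
  rewrite ltr0_norm // rmorphN /= mulNr.
  by have := OKB (OK0 K) Oz; rewrite sub0r.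
Qed.

(** The norms of [y] and of its inverse are, up to sign, positive integers with product 1. *)
Lemma norm_unit (y : K) : OK_unit y -> \prod_i normc (s i y) = 1.
Proof.
move=> [y0 Oy Oy']; have [m [m0 mE _]] := norm_nat Oy y0.
have y'0 : y^-1 != 0 by rewrite invr_eq0.
have [m' [m'0 m'E _]] := norm_nat Oy' y'0.
have : (m * m')%:R = 1 :> R.
  rewrite natrM mE m'E -big_split big1 // => i _ /=.
  by rewrite -normcM -rmorphM mulfV // rmorph1 normc1.
by rewrite -mE => /eqP; rewrite pnatr_eq1 muln_eq1 => /andP[/eqP ->].
Qed.

(* The polynomial with roots s i y is determined by its values N(t - y) at
   t = 0, ..., n + 1, which are bounded integers. *)
Lemma northcott (c : R) : finite_set [set y | OK y /\ forall i, normc (s i y) <= c].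
Proof.
set S := [set y | _].
pose P y : {poly R[i]} := \prod_i ('X - (s i y)%:P).
have PE y (t : nat) : (P y).[t%:R] = \prod_i s i (t%:R - y).
  rewrite horner_prod; apply: eq_bigr => i _.
  by rewrite hornerXsubC rmorphB rmorph_nat.
have c0 y : S y -> 0 <= c by move=> [_ /(_ ord0)]; apply: le_trans; exact: normc_ge0.
(* Each conjugate of t - y has absolute value at most n + 1 + c. *)
pose B := Num.bound ((n.+1%:R + c) ^+ n.+1).
have /choice[F FE] (y : K) : exists z : 'I_n.+2 -> int, S y ->
    forall t : 'I_n.+2, (P y).[t%:R] = (z t)%:~R /\ (`|z t| < B)%N.
  have [Sy|nS] := pselect (S y); last by exists (fun=> 0).
  have [Oy yc] := Sy.
  have H (t : 'I_n.+2) : exists z : int, (P y).[t%:R] = z%:~R /\ (`|z| < B)%N.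
    have Oty : OK (t%:R - y) by apply: OKB => //; exact: (OK_int _ t%:Z).
    have [z zE] := norm_int sx Oty; exists z; rewrite PE zE; split=> //.
    rewrite -(ltr_nat R) pmulrn abszE -normc_int zE normc_prod.
    apply: le_lt_trans (archi_boundP _); last first.
      by rewrite exprn_ge0 // addr_ge0 ?ler0n // (c0 y).
    rewrite -[X in _ ^+ X](card_ord n.+1) -prodr_const; apply: ler_prod => i _.
    rewrite normc_ge0 rmorphB rmorph_nat; apply: le_trans (normcB _ _) _.
    by rewrite normc_nat; apply: lerD; [rewrite ler_nat -ltnS | exact: yc].
  have [z zE] := choice H.
  by exists z => _ t.
pose FF : finType := {ffun 'I_n.+2 -> 'I_(B + B).+1}.
pose G y : FF := [ffun t => inord (absz (F y t + B%:Z)%R)].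
apply: (@sub_finite_set _ _ (\bigcup_(g in [set: FF]) (S `&` [set y | G y = g]))).
  by move=> y Sy; exists (G y).
apply: bigcup_finite => [|g _]; first exact: finite_finset.
(* In a fibre containing [w], every [y] has the same polynomial as [w], so [s ord0 y] is a conjugate
   of [w]. *)
have [->|/set0P[w [Sw Gw]]] := eqVneq (S `&` [set y | G y = g]) set0.
  exact: finite_set0.
apply: (@sub_finite_set _ _ (s ord0 @^-1` [set` [seq s i w | i : 'I_n.+1]])); last first.
  by apply: finite_preimage; [move=> a b _ _; exact: fmorph_inj | exact: finite_seq].
move=> y [Sy Gy]; have Pyw : P y = P w.
  apply/eqP; rewrite -subr_eq0; apply/eqP.
  (* A polynomial of size at most n + 2 that vanishes at 0, ..., n + 1 is zero. *)
  apply: (@roots_geq_poly_eq0 _ _ [seq (val t)%:R | t : 'I_n.+2]).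
  - apply/allP => _ /mapP[t _ ->]; rewrite rootE hornerD hornerN.
    have [-> Ft] := FE _ Sy t; have [-> Ft'] := FE _ Sw t.
    have b1 : (absz (F y t + B%:Z)%R < (B + B).+1)%N by lia.
    have b2 : (absz (F w t + B%:Z)%R < (B + B).+1)%N by lia.
    have := congr1 (fun g : FF => val (g t)) (etrans Gy (esym Gw)).
    rewrite !ffunE /= !inordK // => E.
    by rewrite (_ : F y t = F w t) ?subrr //; lia.
  - rewrite map_inj_uniq ?enum_uniq // => a b /eqP.
    by rewrite eqr_nat => /eqP/val_inj.
  - rewrite size_map size_enum_ord; apply: leq_trans (size_polyD _ _) _.
    have szP u : size (P u) = n.+2.
      by rewrite /P -big_enum size_prod_XsubC size_enum_ord.
    by rewrite size_polyN !szP maxnn.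
have : root (P w) (s ord0 y).
  by rewrite -Pyw rootE horner_prod (bigD1 ord0) //= hornerXsubC subrr mul0r.
rewrite /P rootE horner_prod => /prodf_eq0[i _]; rewrite hornerXsubC subr_eq0 => /eqP E.
by apply/mapP; exists i; rewrite ?mem_enum.
Qed.

End Northcott.

(** * Independent units are bounded in number *)

Section UnitRank.
Variables (R : realType) (K : fieldExtType rat).

Section Log.
Variable t : {rmorphism K -> R[i]}.

Definition lognorm (y : K) : R := ln (normc (t y)).

Lemma normc_embedding_gt0 y : (0 < normc (t y)) = (y != 0).
Proof. by rewrite normc_gt0 fmorph_eq0. Qed.

Lemma lognorm1 : lognorm 1 = 0.
Proof. by rewrite /lognorm rmorph1 normc1 ln1. Qed.

Lemma lognormM y z : y != 0 -> z != 0 -> lognorm (y * z) = lognorm y + lognorm z.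
Proof. by move=> y0 z0; rewrite /lognorm rmorphM normcM lnM // posrE normc_embedding_gt0. Qed.

Lemma lognormX y k : y != 0 -> lognorm (y ^+ k) = lognorm y *+ k.
Proof.
move=> y0; elim: k => [|k IH]; first by rewrite expr0 lognorm1.
by rewrite exprS mulrS lognormM ?expf_neq0 ?IH.
Qed.

Lemma lognormXz y (e : int) : y != 0 -> lognorm (y ^ e) = e%:~R * lognorm y.
Proof.
move=> y0; case: e => k; first by rewrite -exprnP lognormX // mulr_natl.
rewrite NegzE -exprnN; apply: (addIr (lognorm (y ^+ k.+1))).
rewrite -lognormM ?invr_eq0 ?expf_neq0 // mulVf ?expf_neq0 // lognorm1.
by rewrite lognormX // -mulr_natl rmorphN mulNr addNr.
Qed.

Lemma lognorm_prod d (u : 'I_d -> K) (e : 'I_d -> int) :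
  (forall j, u j != 0) -> lognorm (\prod_j u j ^ e j) = \sum_j (e j)%:~R * lognorm (u j).
Proof.
move=> u0; rewrite -(eq_bigr _ (fun j _ => lognormXz (e j) (u0 j))).
elim: (index_enum _) => [|j r IH]; first by rewrite !big_nil lognorm1.
rewrite !big_cons -IH lognormM ?expfz_neq0 // prodf_seq_neq0.
by apply/allP => k _; rewrite expfz_neq0.
Qed.

End Log.

Variables (n : nat) (s : 'I_n.+1 -> {rmorphism K -> R[i]}) (x : K).
Hypothesis sx : embedding_system s x.

(* More than n + 1 independent units would have products v, not roots of unity,
   with arbitrarily small logarithms, hence too many powers v ^+ k in a bounded
   region. *)
Lemma independent_units_bound d (u : 'I_d -> K) :
  (forall i, OK_unit (u i)) -> mul_independent u -> (d <= n.+1)%N.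
Proof.
move=> Uu indu; rewrite leqNgt; apply/negP => nd.
have u0 j : u j != 0 by have [] := Uu j.
pose C := Num.bound (\sum_i \sum_j `|lognorm (s i) (u j)|).
have lC i j : `|lognorm (s i) (u j)| <= C%:R.
  apply: ltW; apply: le_lt_trans (archi_boundP _); last first.
    by rewrite sumr_ge0 // => ? _; rewrite sumr_ge0.
  rewrite (bigD1 i) //= (bigD1 j) //= -addrA lerDl addr_ge0 ?sumr_ge0 //.
  by move=> ? _; rewrite sumr_ge0.
have /finite_seqP[ss Sss] := northcott sx (expR 1); set S := [set _ | _] in Sss.
pose F := size ss.
pose c := (2 * d * C).+1.
(* With M = c (F + 1) the logarithms of [v] are at most 1 / (F + 1), so all powers up to F have
   logarithms at most 1 and lie in [S]. *)
have M0 : (0 < c * F.+1)%N by rewrite muln_gt0.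
have [|e [[j0 ej0] _ eM]] :=
    @pigeonhole_linear_forms _ _ d (fun i => lognorm (s i) \o u) C _ _ M0 lC.
  by rewrite card_ord.
pose v := \prod_j u j ^ e j.
have Uv : OK_unit v by apply: OK_unit_prod => j; exact: OK_unitXz.
have v0 : v != 0 by have [] := Uv.
have lv i : `|lognorm (s i) v| <= F.+1%:R^-1.
  rewrite lognorm_prod //; apply: le_trans (eM i) _; rewrite card_ord -/c.
  have -> : c%:R = F.+1%:R^-1 * (c * F.+1)%:R :> R by rewrite natrM mulrCA mulVf ?mulr1.
  rewrite -mulrA ler_piMr ?invr_ge0 // ler_pdivrMr ?exprn_gt0 ?ltr0n // mul1r.
  by rewrite ler_eXnr ?subn_gt0 // ler1n.
have vS k : (k <= F)%N -> S (v ^+ k).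
  move=> kF; split; first by have [_ ? _] := Uv; exact: OKX.
  move=> i; have vk0 : 0 < normc (s i (v ^+ k)) by rewrite normc_embedding_gt0 expf_neq0.
  rewrite -ler_ln ?posrE ?expR_gt0 // expRK -/(lognorm _ _) lognormX //.
  apply: le_trans (ler_norm _) _; rewrite normrMn -mulr_natr.
  apply: (@le_trans _ _ (F.+1%:R^-1 * F.+1%:R)); last by rewrite mulVf.
  by rewrite ler_pM // ler_nat ltnW.
(* An equality would make [v] a root of unity, against independence, as [e j0] is nonzero. *)
have vinj k k' : (k < k')%N -> v ^+ k <> v ^+ k'.
  move=> kk' E; have : v ^+ (k' - k) = 1.
    by apply: (mulfI (expf_neq0 k v0)); rewrite -exprD subnKC ?mulr1 ?E // ltnW.
  rewrite -prodrXl => E1.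
  have E2 : \prod_j u j ^ (e j * (k' - k)%:Z) = 1.
    by rewrite -[RHS]E1; apply: eq_bigr => j _; rewrite -exprz_exp.
  have /eqP := indu _ E2 j0; rewrite mulf_eq0 (negbTE ej0) /= eqz_nat.
  by rewrite subn_eq0 leqNgt kk'.
pose r := [seq v ^+ k | k <- iota 0 F.+1].
have : (size r <= F)%N.
  apply: uniq_leq_size; last first.
    move=> y /mapP[k]; rewrite mem_iota => /andP[_ kF] ->.
    by have := vS _ kF; rewrite Sss.
  rewrite map_inj_in_uniq ?iota_uniq // => k k' _ _ E.
  by case: (ltngtP k k') => // /vinj[]; rewrite E.
by rewrite size_map size_iota ltnn.
Qed.

(** [max_nat] falls back to 0 on unbounded sets; [independent_units_bound] is what makes [unit_rank]
    a true maximum. *)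
Lemma independent_le_unit_rank d (u : 'I_d -> K) :
  (forall i, OK_unit (u i)) -> mul_independent u -> (d <= unit_rank K)%N.
Proof.
move=> Uu indu; rewrite /unit_rank /max_nat; set P := [set d | exists _, _].
have Pd : P d by exists u.
have Pb e : P e -> (e <= n.+1)%N.
  by move=> [w [Uw indw]]; exact: independent_units_bound Uw indw.
have exP : exists e, `[< P e >] by exists d; apply/asboolP.
have bP e : `[< P e >] -> (e <= n.+1)%N by move=> /asboolP/Pb.
have [m /asboolP Pm mP] := ex_maxnP exP bP.
have [|_] := @xgetPex _ 0%N [set d | P d /\ forall e, P e -> (e <= d)%N].
  by exists m; split=> // e Pe; apply: mP; exact/asboolP.
by apply.
Qed.

End UnitRank.

(** * Units dominant at one place *)

(** Otherwise every value is avoided beyond some index, and the value at the largest of these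
    indices is a contradiction. *)
Lemma infinite_fiber (T : finType) (f : nat -> T) :
  exists y, forall N, exists2 M, (N <= M)%N & f M = y.
Proof.
apply: contrapT => /forallNP H.
have /choice[N HN] (y : T) : exists N, forall M, (N <= M)%N -> f M <> y.
  by have /existsNP[N HN] := H y; exists N => M NM fM; apply: HN; exists M.
by apply: (HN (f (\max_y N y)) (\max_y N y)) => //; exact: leq_bigmax.
Qed.

Section DominantUnits.
Variables (R : realType) (K : fieldExtType rat).

(** Meant for [N] the norm of [y]: z / y = 1 + w (m / N) (N / y), and each term is integral. *)
Lemma OK_quotient (y z w : K) (N m : nat) :
  y != 0 -> OK w -> z - y = m%:R * w -> (0 < N)%N -> (N %| m)%N -> OK (N%:R / y) -> OK (z / y).
Proof.
move=> y0 Ow zy N0 /dvdnP[k mE] ON.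
have -> : z / y = 1 + w * (k%:R * (N%:R / y)).
  rewrite (_ : z = y + m%:R * w); last by rewrite -zy addrC subrK.
  by rewrite mE natrM mulrDl mulfV //; ring.
by apply: OKD; [exact: OK1 | apply: OKM => //; apply: OKM => //; exact: (OK_int _ k%:Z)].
Qed.

Variables (n : nat) (s : 'I_n.+1 -> {rmorphism K -> R[i]}) (x : K).
Hypothesis sx : embedding_system s x.

Lemma conj_embedding : exists c : 'I_n.+1 -> 'I_n.+1,
  involutive c /\ forall i y, s (c i) y = conjc (s i y).
Proof.
have [_ inj cpl _ _] := sx.
have /choice[c cE] (i : 'I_n.+1) : exists j, forall y, s j y = conjc (s i y).
  by have [j jE] := cpl (conjc \o s i); exists j => y; rewrite -jE.
by exists c; split=> // i; apply: inj; rewrite !cE conjcK.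
Qed.

Variable c : 'I_n.+1 -> 'I_n.+1.
Hypotheses (cK : involutive c) (cE : forall i y, s (c i) y = conjc (s i y)).

(** The embeddings inducing the same place as [s k]. *)
Let cls k : pred 'I_n.+1 := [pred i | (i == k) || (i == c k)].

(* Pigeonhole on the real linear forms Re (s i y) + Im (s i y): when i is not
   real, the two forms attached to i and c i determine Re (s i y) and
   Im (s i y), so that real and complex embeddings are treated uniformly. *)
Lemma small_elements k : exists (B : nat) (C : R), 0 < C /\
  forall M, (0 < M)%N -> exists e : 'I_n.+1 -> int, let y := \sum_j (e j)%:~R * x ^+ j in
    [/\ y != 0, \prod_i normc (s i y) <= B%:R
      & forall i, ~~ cls k i -> normc (s i y) <= C / M%:R].
Proof.
have [Ox _ _ _ free] := sx.
pose T : finType := {i : 'I_n.+1 | ~~ cls k i}.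
have cT : #|T| = #|[pred i | ~~ cls k i]| by rewrite card_sig.
set m := #|[pred i | ~~ cls k i]| in cT.
have cC : #|cls k| = (n.+1 - m)%N.
  have : (#|cls k| + m = n.+1)%N.
    by rewrite /m -[RHS](card_ord n.+1) -(cardC (cls k)); congr addn; apply: eq_card.
  by lia.
have mn : (m < n.+1)%N.
  by rewrite -subn_gt0 -cC; apply/card_gt0P; exists k; rewrite !inE eqxx.
pose A := Num.bound (\sum_i \sum_(j < n.+1) normc (s i (x ^+ j)) *+ 2).
have lA (i j : 'I_n.+1) : normc (s i (x ^+ nat_of_ord j)) *+ 2 <= A%:R.
  apply: ltW; apply: le_lt_trans (archi_boundP _); last first.
    by rewrite sumr_ge0 // => ? _; rewrite sumr_ge0 // => ? _; rewrite mulrn_wge0 ?normc_ge0.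
  rewrite (bigD1 i) //= (bigD1 j) //= -addrA lerDl addr_ge0 ?sumr_ge0 //.
    by move=> ? _; rewrite mulrn_wge0 ?normc_ge0.
  by move=> ? _; rewrite sumr_ge0 // => ? _; rewrite mulrn_wge0 ?normc_ge0.
pose rho i y : R := complex.Re (s i y) + complex.Im (s i y).
have rhoE i (e : 'I_n.+1 -> int) :
    rho i (\sum_j (e j)%:~R * x ^+ j) = \sum_j (e j)%:~R * rho i (x ^+ j).
  rewrite /rho rmorph_sum; elim/big_rec2: _ => [|j z w _]; first by rewrite addr0.
  rewrite rmorphM rmorph_int; case: w => a b; case: (s i _) => a' b' /= <-.
  have -> : ((e j)%:~R : R[i]) = ((e j)%:~R)%:C%C by rewrite rmorph_int.
  by rewrite /=; ring.
have lrho (t : T) (j : 'I_n.+1) : `|rho (val t) (x ^+ nat_of_ord j)| <= A%:R.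
  apply: le_trans (ler_normD _ _) _; apply: le_trans (lA (val t) j).
  by rewrite mulr2n lerD ?Re_le_normc ?Im_le_normc.
pose b := (2 * n.+1 * A).+1.
pose C : R := b%:R *+ 2.
(* The norm is bounded by C / M ^ (n + 1 - m) at each of the m embeddings outside the class, times
   (n + 1) A M ^ m at each of the n + 1 - m inside it; the powers of M cancel. *)
exists (Num.bound (C ^+ m * (n.+1 * A)%:R ^+ (n.+1 - m))), C; split.
  by rewrite pmulrn_lgt0 ?ltr0n.
move=> M M0; have [|e [[j0 ej0] eM el]] :=
    @pigeonhole_linear_forms R _ n.+1
      (fun (t : T) j => rho (val t) (x ^+ nat_of_ord j)) A M _ M0 lrho.
  by rewrite cT.
exists e => /=; set y := \sum_j _.
rewrite cT in eM el.
have y0 : y != 0.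
  apply: contra ej0 => /eqP y0; rewrite -(intr_eq0 rat).
  apply/eqP/(free (fun j => (e j)%:~R)); rewrite -[RHS]y0; apply: eq_bigr => j _.
  by rewrite intr_alg mulr_algl.
have ccls i : ~~ cls k i -> ~~ cls k (c i).
  rewrite /cls /= (inj_eq (inv_inj cK)) orbC; congr (~~ (_ || _)).
  by apply/eqP/eqP => [->|<-]; rewrite cK.
have Mm : 0 < M%:R ^+ (n.+1 - m) :> R by rewrite exprn_gt0 ?ltr0n.
have [D DE CD] : exists2 D : R, D = b%:R / M%:R ^+ (n.+1 - m)
    & C / M%:R ^+ (n.+1 - m) = D + D.
  by eexists; [reflexivity | rewrite -[RHS]mulr2n -mulrnAl].
have el' i : ~~ cls k i -> `|rho i y| <= D.
  by move=> ik; rewrite rhoE DE; exact: (el (exist (fun i => ~~ cls k i) i ik)).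
have small i : ~~ cls k i -> normc (s i y) <= C / M%:R ^+ (n.+1 - m).
  move=> ik; have := el' i ik; have := el' _ (ccls _ ik).
  rewrite /rho cE CD; move: (normc_ReIm (s i y)); case: (s i y) => u v /=.
  rewrite !ler_norml => H /andP[h1 h2] /andP[h3 h4]; apply: le_trans H _.
  by case: (ger0P u) => _; case: (ger0P v) => _; lra.
have big i : normc (s i y) <= (n.+1 * A)%:R * M%:R ^+ m.
  have -> : (n.+1 * A)%:R * M%:R ^+ m = \sum_(j < n.+1) (M%:R ^+ m * A%:R) :> R.
    by rewrite sumr_const card_ord -[RHS]mulr_natr natrM; ring.
  rewrite rmorph_sum; elim/big_rec2: _ => [|j z w _ IH]; first by rewrite normc0.
  apply: le_trans (normcD _ _) _; rewrite lerD // rmorphM normcM rmorph_int normc_int.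
  apply: ler_pM; rewrite ?ler0z ?normc_ge0 //.
    by rewrite -natrX -abszE -pmulrn ler_nat.
  by apply: le_trans (lA i j); rewrite mulr2n lerDl normc_ge0.
split=> // [|i ik]; last first.
  apply: le_trans (small i ik) _; rewrite ler_pM2l ?pmulrn_lgt0 ?ltr0n //.
  rewrite lef_pV2 ?posrE ?ltr0n //; by rewrite ler_eXnr ?ler1n // subn_gt0.
apply: ltW; apply: le_lt_trans (archi_boundP _); last first.
  by rewrite mulr_ge0 ?exprn_ge0 ?mulrn_wge0 ?ler0n.
rewrite (bigID (cls k)) /= mulrC.
have -> : C ^+ m * (n.+1 * A)%:R ^+ (n.+1 - m) =
   (\prod_(i | ~~ cls k i) (C / M%:R ^+ (n.+1 - m)))
   * \prod_(i | cls k i) ((n.+1 * A)%:R * M%:R ^+ m).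
  rewrite !prodr_const -/m cC !exprMn exprVn -!exprM [(m * _)%N]mulnC mulrACA.
  by rewrite mulVf ?mulr1 // expf_neq0 // pnatr_eq0 -lt0n.
apply: ler_pM; rewrite ?prodr_ge0 //; try by move=> *; exact: normc_ge0.
  by apply: ler_prod => i ik; rewrite normc_ge0 small.
by apply: ler_prod => i _; rewrite normc_ge0 big.
Qed.

(* Two elements with norms dividing B`! and congruent modulo B`! are associates. *)
Lemma dominant_unit k : exists u : K, OK_unit u /\
  forall i, i != k -> i != c k -> normc (s i u) < 1.
Proof.
have [Ox _ _ _ _] := sx.
have [B [C [C0 H]]] := small_elements k.
have /choice[e eP] (M : nat) := H M.+1 (ltn0Sn M).
pose y M := \sum_j (e M j)%:~R * x ^+ j.
have Oy M : OK (y M).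
  by apply: OK_sum => j; apply: OKM; [exact: OK_int | exact: OKX].
have y0 M : y M != 0 by have [] := eP M.
have Bf : (0 < B`!)%N by rewrite fact_gt0.
(* Coordinates in the power basis modulo the factorial of B: equal values mean congruent
   elements. *)
pose g M : {ffun 'I_n.+1 -> 'I_(B`!).-1.+1} := [ffun j => inord (absz (e M j %% B`!%:Z)%Z)].
have [g0 gP] := infinite_fiber g.
have congr M M' : g M = g M' -> exists2 w, OK w & y M' - y M = B`!%:R * w.
  move=> gM; have eM j : (e M' j - e M j)%R = (B`!%:Z * ((e M' j - e M j) %/ B`!%:Z)%Z)%R.
    have Bz : B`!%:Z != 0 by rewrite eqz_nat -lt0n.
    have lt M1 : (absz (e M1 j %% B`!%:Z)%Z < (B`!).-1.+1)%N.
      rewrite prednK // -ltz_nat gez0_abs ?modz_ge0 //.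
      by have := ltz_mod (e M1 j) Bz; rewrite ger0_norm.
    have := congr1 (fun f : {ffun 'I_n.+1 -> 'I_(B`!).-1.+1} => nat_of_ord (f j)) gM.
    rewrite !ffunE !inordK // => /(congr1 Posz); rewrite !gez0_abs ?modz_ge0 // => E.
    by rewrite mulrC divzK // -eqz_mod_dvd; apply/eqP.
  exists (\sum_j ((e M' j - e M j) %/ B`!%:Z)%Z%:~R * x ^+ j).
    by apply: OK_sum => j; apply: OKM; [exact: OK_int | exact: OKX].
  rewrite mulr_sumr -sumrB; apply: eq_bigr => j _.
  by rewrite mulrA -mulrBl -rmorphB /= {1}eM rmorphM.
(* The norm of [y M] is at most B, hence divides the factorial of B. *)
have quot M M' : g M = g M' -> OK (y M' / y M).
  move=> gM; have [w Ow wE] := congr _ _ gM.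
  have [N [N0 NE ON]] := norm_nat sx (Oy M) (y0 M).
  apply: (OK_quotient (y0 M) Ow wE N0 _ ON); apply: dvdn_fact; rewrite N0 /=.
  by rewrite -(ler_nat R) NE; have [] := eP M.
have [M _ gM] := gP 0%N.
(* From [D] on, the bound C / (M' + 1) is below the absolute values of all conjugates of [y M]. *)
pose D := \max_i Num.bound (C / normc (s i (y M))).
have [M' DM gM'] := gP D.
exists (y M' / y M); split.
  split; first by rewrite mulf_neq0 ?invr_eq0 ?y0.
    by apply: quot; rewrite gM gM'.
  by rewrite invf_div; apply: quot; rewrite gM gM'.
move=> i ik ick; have sM : 0 < normc (s i (y M)) by rewrite normc_embedding_gt0 y0.
rewrite rmorphM fmorphV normcM normcV ltr_pdivrMr // mul1r.
have [_ _ /(_ i)] := eP M'; rewrite -/(y M') => /(_ _)/le_lt_trans; apply.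
  by rewrite /cls /= negb_or ik ick.
rewrite ltr_pdivrMr ?ltr0n // mulrC -ltr_pdivrMr //.
apply: lt_le_trans (archi_boundP _) _; first by rewrite divr_ge0 // ltW.
rewrite ler_nat; apply: leq_trans (leqnSn _); apply: leq_trans DM.
exact: leq_bigmax.
Qed.

End DominantUnits.

(** * Diagonally dominant matrices *)

Section Dominance.
Variables (R : realFieldType) (I : finType) (rep : I -> I) (D : {set I}) (a : I -> I -> R).
Hypotheses (repD : forall k, k \in D -> rep k = k).
Hypothesis a_lt0 : forall i k, k \in D -> rep i != k -> a i k < 0.
Hypothesis a_sum : forall k, k \in D -> \sum_i a i k = 0.
Hypothesis D_missing : exists i, rep i \notin D.

(* Sum the relation over the classes of the k for which f k > 0: there, every
   column of a has a sum of the same sign as f k. *)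
Lemma dominant_relation_le0 (f : I -> R) :
  (forall i, \sum_(k in D) f k * a i k = 0) -> forall k, k \in D -> f k <= 0.
Proof.
move=> fa k kD; rewrite leNgt; apply/negP => fk.
pose J := [pred i | (rep i \in D) && (0 < f (rep i))].
have : \sum_(k in D) f k * \sum_(i | J i) a i k = 0.
  under eq_bigr do rewrite mulr_sumr.
  by rewrite exchange_big /= big1.
(* Column [j] sums to 0, and its entries outside [J] are negative and exist by [D_missing]. *)
have pos j : j \in D -> 0 < f j -> 0 < \sum_(i | J i) a i j.
  move=> jD fj; have [i0 i0D] := D_missing.
  have := a_sum jD; rewrite (bigID J) /= => /eqP; rewrite addr_eq0 => /eqP ->.
  have nJ i : ~~ J i -> a i j < 0.
    move=> nJi; apply: a_lt0 => //; apply: contra nJi => /eqP Ei.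
    by rewrite /J /= Ei jD.
  have Ji0 : ~~ J i0 by rewrite /J /= negb_and i0D.
  rewrite oppr_gt0 (bigD1 i0) //= -[ltRHS]addr0; apply: ltr_leD; first exact: nJ.
  by apply: sumr_le0 => i /andP[Ji _]; apply/ltW/nJ.
(* If f j <= 0, the class of [j] does not meet [J], so only negative entries are summed. *)
have nonneg j : j \in D -> 0 <= f j * \sum_(i | J i) a i j.
  move=> jD; case: (ltP 0 (f j)) => fj; first by rewrite mulr_ge0 ?ltW ?pos.
  rewrite mulr_le0 // sumr_le0 // => i /andP[_ fi].
  by apply/ltW/a_lt0 => //; apply: contraTneq fi => ->; rewrite -leNgt.
rewrite (bigD1 k) //= => /eqP; rewrite gt_eqF // ltr_pwDl ?mulr_gt0 ?pos //.
by apply: sumr_ge0 => j /andP[jD _]; exact: nonneg.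
Qed.

Lemma dominant_relation_eq0 (f : I -> R) :
  (forall i, \sum_(k in D) f k * a i k = 0) -> forall k, k \in D -> f k = 0.
Proof.
move=> fa k kD; apply/eqP; rewrite eq_le dominant_relation_le0 //=.
rewrite -oppr_le0; apply: (@dominant_relation_le0 (fun k => - f k)) => // i.
by under eq_bigr do rewrite mulNr; rewrite sumrN fa oppr0.
Qed.

End Dominance.

(** * Lower bound for the unit rank *)

Section DirichletRank.
Variables (R : realType) (K : fieldExtType rat).
Variables (n : nat) (s : 'I_n.+1 -> {rmorphism K -> R[i]}) (x : K).
Hypothesis sx : embedding_system s x.
Variable c : 'I_n.+1 -> 'I_n.+1.
Hypotheses (cK : involutive c) (cE : forall i y, s (c i) y = conjc (s i y)).

(** The smaller index of a conjugate pair: one embedding per archimedean place. *)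
Definition conj_rep (i : 'I_n.+1) : 'I_n.+1 := if (i <= c i)%N then i else c i.

Lemma conj_rep_cases i k : conj_rep k = k -> i = k \/ i = c k -> conj_rep i = k.
Proof.
rewrite /conj_rep => kk [->//|->]; rewrite cK; move: kk.
by case: ltngtP => // E _; exact/val_inj.
Qed.

Lemma conj_rep_idem i : conj_rep (conj_rep i) = conj_rep i.
Proof.
by rewrite /conj_rep; case: (leqP i (c i)) => ic; rewrite ?ic // cK (ltnW ic).
Qed.

(** Omit one representative [k0] and take a dominant unit for each other one. In the matrix of
    logarithms, columns sum to 0 because units have norm 1, and entries off the class of the column
    are negative; dominance gives independence. *)
Lemma unit_rank_ge : (#|[set conj_rep i | i : 'I_n.+1]| <= (unit_rank K).+1)%N.
Proof.
set Reps : {set 'I_n.+1} := imset _ _.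
have repR k : k \in Reps -> conj_rep k = k by move=> /imsetP[i _ ->]; exact: conj_rep_idem.
pose k0 := conj_rep ord0; have k0R : k0 \in Reps by exact: imset_f.
pose D := Reps :\ k0.
rewrite (cardsD1 k0) k0R add1n ltnS -/D.
have repD k : k \in D -> conj_rep k = k by rewrite !inE => /andP[_ /repR].
have /choice[u uP] := dominant_unit sx cK cE.
apply: (independent_le_unit_rank sx (u := fun j : 'I_#|D| => u (enum_val j))).
  by move=> j; have [] := uP (enum_val j).
move=> e ue1 j.
have u0 k : u k != 0 by have [[]] := uP k.
(* The exponents, extended by 0 outside [D]. *)
pose f k : R := \sum_(j | enum_val j == k) (e j)%:~R.
have fE j' : f (enum_val j') = (e j')%:~R.
  by rewrite /f (big_pred1 j') // => j''; rewrite /= (inj_eq enum_val_inj).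
apply/eqP; rewrite -(intr_eq0 R) -fE; apply/eqP.
apply: (@dominant_relation_eq0 _ _ conj_rep D (fun i k => lognorm (s i) (u k))) => //.
- move=> i k kD ik; have [_ uk] := uP k.
  rewrite /lognorm ln_lt0 // normc_embedding_gt0 u0 uk //.
    by apply: contra ik => /eqP ik; apply/eqP/conj_rep_cases; [exact: repD | left].
  by apply: contra ik => /eqP ik; apply/eqP/conj_rep_cases; [exact: repD | right].
- move=> k kD; have [Uk _] := uP k.
  rewrite -[RHS]ln1 -(norm_unit sx Uk) /lognorm.
  have : forall i, 0 < normc (s i (u k)) by move=> i; rewrite normc_embedding_gt0 u0.
  move: (fun i => normc (s i (u k))) => g g0.
  elim: (index_enum _) => [|i r IH]; first by rewrite !big_nil ln1.
  by rewrite !big_cons IH lnM // posrE ?prodr_gt0.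
- by exists ord0; rewrite !inE eqxx.
- move=> i; rewrite -[RHS](lognorm1 (s i)) -ue1 lognorm_prod //.
  by rewrite big_enum_val; apply: eq_bigr => j' _; rewrite fE.
- exact: enum_valP.
Qed.

End DirichletRank.

(** * Non-archimedean places *)

Section PrimeIdeals.
Variable K : fieldExtType rat.
Implicit Types (I J P Q : set K) (y : K).

Lemma ideal_sum P n (F : 'I_n -> K) : OK_ideal P -> (forall i, P (F i)) -> P (\sum_i F i).
Proof. by move=> [_ P0 PD _] PF; elim/big_ind: _. Qed.

Lemma idealB P y z : OK_ideal P -> P y -> P z -> P (y - z).
Proof.
move=> [_ _ PD PM] Py Pz; apply: PD => //; rewrite -mulN1r; apply: PM => //.
exact: (OK_int _ (-1)).
Qed.

(** The norm of [y] is a multiple of [y] by an integral element, so it lies in [P]. *)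
Lemma ideal_nonzero_nat P y : OK_ideal P -> P y -> y != 0 ->
  exists2 m : nat, (0 < m)%N & P m%:R.
Proof.
move=> idP Py y0; have [PO _ _ PM] := idP.
have [n [s [x sx]]] := embedding_system_exists K algC.
have Oy := PO _ Py; have [z zE] := norm_int sx Oy.
have Pz : P z%:~R by rewrite -(divfK y0 z%:~R); apply: PM => //; exact: norm_divisible zE.
exists `|z|%N.
  rewrite absz_gt0 -(intr_eq0 algC) zE; apply/prodf_neq0 => i _.
  by rewrite fmorph_eq0.
rewrite pmulrn abszE; case: (leP 0 z) => z0; first by rewrite ger0_norm.
rewrite ltr0_norm // rmorphN -mulN1r; apply: PM => //; exact: (OK_int _ (-1)).
Qed.

(* Nonzero primes are maximal: first P and Q have the same integers, then one
   descends along a monic polynomial with value in Q at an element of P. *)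
Lemma prime_sub_eq P Q : OK_prime P -> OK_prime Q -> Q `<=` P -> Q = P.
Proof.
move=> [idP _ P1 _] [idQ [q0 Qq0 q00] Q1 primQ] QP.
have [PO P0 PD PM] := idP; have [QO Q0 QD QM] := idQ.
have [m0 m00 Qm0] := ideal_nonzero_nat idQ Qq0 q00.
have exQ : exists m, [&& (0 < m)%N & `[< Q m%:R >]] by exists m0; rewrite m00; apply/asboolP.
have [q /andP[q_gt0 /asboolP Qq] qmin] := ex_minnP exQ.
(* With g = gcd(z, q) in [P] and q = h g in [Q]: either h is in [Q], and minimality of q forces g =
   1, absurd; or g is in [Q], so g = q divides z. *)
have intPQ (z : int) : P z%:~R -> Q z%:~R.
  move=> Pz; have [u [v uv]] := Bezoutz z q%:Z.
  set g := gcdz z q in uv.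
  have g0 : (0 < `|g|)%N by rewrite absz_gt0 gcdz_eq0 negb_and !eqz_nat orbC -lt0n q_gt0.
  have gE : g = `|g|%N by rewrite /g /gcdz.
  have Pg : P g%:~R.
    rewrite -uv rmorphD !rmorphM; apply: PD; apply: PM => //; try exact: OK_int.
    exact: QP.
  have /dvdzP[h hE] : (g %| q%:Z)%Z by exact: dvdz_gcdr.
  have gz : 0 < g by rewrite gE ltz_nat.
  have h0 : 0 < h by rewrite -(pmulr_lgt0 _ gz) -hE ltz_nat.
  have : Q (h%:~R * g%:~R) by rewrite -rmorphM -hE.
  move=> /(primQ _ _ (OK_int _ _) (OK_int _ _))[Qh|Qg].
    have := qmin `|h|%N; rewrite absz_gt0 (gt_eqF h0) /= => /(_ _) H.
    have {}H : (q <= `|h|)%N by apply: H; apply/asboolP; rewrite pmulrn gtz0_abs.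
    have g1 : g = 1 by nia.
    by case: P1; move: Pg; rewrite g1.
  have {}H : (q <= `|g|)%N by apply: qmin; rewrite g0; apply/asboolP; rewrite pmulrn -gE.
  have gq : g = q by nia.
  have /dvdzP[k ->] : (q%:Z %| z)%Z by rewrite -gq; exact: dvdz_gcdl.
  by rewrite rmorphM; apply: QM => //; exact: OK_int.
apply/seteqP; split=> // y Py; apply: contrapT => nQy.
(* If p = p1 X + z has its value in [Q], then z is in [P], hence in [Q]; as [y] is outside [Q], the
   value of p1 is in [Q]. The descent ends at the constant 1. *)
have desc (p : {poly int}) : p \is monic -> ~ Q (map_poly intr p).[y].
  elim/poly_ind: p => [|p z IH]; first by rewrite monicE lead_coef0 eq_sym oner_eq0.
  rewrite rmorphD rmorphM /= map_polyX map_polyC /= hornerD hornerMX hornerC.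
  have [->|p0] := eqVneq p 0.
    rewrite mul0r add0r monicE lead_coefC => /eqP ->.
    by rewrite rmorph0 horner0 mul0r add0r.
  move=> pm Qpy.
  have Op : OK (map_poly intr p).[y].
    apply: integral_horner; last exact: PO.
    by apply/integral_poly => i; rewrite coef_map; exact: OK_int.
  have pm' : p \is monic.
    move: pm; rewrite !monicE lead_coefDl ?lead_coefMX //.
    by rewrite size_mulX // ltnS size_polyC; case: (z != 0) => //=; rewrite size_poly_gt0.
  apply: (IH pm'); have Qz : Q z%:~R.
    apply: intPQ; rewrite -[z%:~R](addKr ((map_poly intr p).[y] * y)) addrC.
    by apply: idealB idP (QP _ Qpy) _; exact: PM.
  have : Q ((map_poly intr p).[y] * y) by rewrite -[_ * y](addrK z%:~R); exact: idealB.
  by move=> /(primQ _ _ Op (PO _ Py))[].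
have [p pm /eqP py] := PO _ Py.
by apply: (desc p pm); rewrite py.
Qed.

Lemma ideal_prod_OK (t : seq (set K)) :
  (forall P, P \in t -> P `<=` @OK K) -> ideal_prod t `<=` @OK K.
Proof.
elim: t => [|I t IH] tO //= _ [n [a [b [ab ->]]]].
apply: OK_sum => i; have [Ia Jb] := ab i; apply: OKM.
  by apply: (tO I) => //; rewrite mem_head.
by apply: IH Jb => P Pt; apply: tO; rewrite inE Pt orbT.
Qed.

Lemma ideal_prod_sub (t : seq (set K)) P : (forall Q, Q \in t -> Q `<=` @OK K) ->
  OK_ideal P -> P \in t -> ideal_prod t `<=` P.
Proof.
move=> tO idP; have [_ _ _ PM] := idP.
elim: t tO => // I t IH tO; rewrite inE => Pt _ /= [n [a [b [ab ->]]]].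
have tO' Q : Q \in t -> Q `<=` @OK K by move=> Qt; apply: tO; rewrite inE Qt orbT.
apply: ideal_sum => // i; have [Ia Jb] := ab i.
move: Pt => /orP[/eqP PI|Pt].
  by rewrite mulrC; apply: PM; [exact: ideal_prod_OK Jb | rewrite PI].
by apply: PM; [apply: (tO I) => //; rewrite mem_head | exact: IH Jb].
Qed.

(** If the first factor is not contained in [P], primality puts the product of the others inside
    [P]. *)
Lemma prime_contains_factor (t : seq (set K)) P : (forall Q, Q \in t -> Q `<=` @OK K) ->
  OK_prime P -> ideal_prod t `<=` P -> exists2 Q, Q \in t & Q `<=` P.
Proof.
move=> + [_ _ P1 primP]; elim: t => [|I t IH] tO /= tP.
  by case: P1; apply: tP; exact: OK1.
have tO' Q : Q \in t -> Q `<=` @OK K by move=> Qt; apply: tO; rewrite inE Qt orbT.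
have [IP|/existsNP[y /not_implyP[Iy nPy]]] := pselect (I `<=` P).
  by exists I; rewrite ?mem_head.
have [Q Qt QP] : exists2 Q, Q \in t & Q `<=` P.
  apply: IH => // z Jz; have : P (y * z).
    by apply: tP; exists 1%N, (fun=> y), (fun=> z); split=> //; rewrite big_ord1.
  by case/primP => //; [apply: (tO I) => //; rewrite mem_head | exact: ideal_prod_OK Jz].
by exists Q => //; rewrite inE Qt orbT.
Qed.

(** A [P] in the denominator would contain the numerator, hence equal one of its factors by
    maximality, against lowest terms. *)
Lemma pval_ge0 P y : OK_prime P -> OK y -> 0 <= pval P y.
Proof.
(* Without a factorization [xget] returns 0, which satisfies the bound. *)
move=> primeP Oy; rewrite /pval; case: xgetP => // n _ [s [t [[sP tP st yE] ->]]].
have OKP Q : OK_prime Q -> Q `<=` @OK K by case=> -[].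
have [Pt|Pt] := boolP (P \in t); last by rewrite (count_memPn Pt) subr0.
have [idP _ _ _] := primeP; have [_ _ _ PM] := idP.
have [||Q Qs QP] := @prime_contains_factor s P _ primeP.
- by move=> Q /sP/OKP.
- rewrite -yE => _ [z tz <-]; apply: PM => //; apply: ideal_prod_sub tz => // Q.
  by move=> /tP/OKP.
by have := st _ Qs; rewrite (prime_sub_eq primeP (sP _ Qs) QP) Pt.
Qed.

Lemma nonarch_place_le1 (R : realType) (v : K -> R) y :
  nonarch_place v -> OK y -> v y <= 1.
Proof.
move=> [P [p [primeP pp Pp ->]]] Oy; rewrite /padic_abs; case: ifP => // _.
rewrite -[leRHS](powRr0 p%:R); apply: ler_powR; first by rewrite ler1n prime_gt0.
rewrite oppr_le0 divr_ge0 // ler0z; first exact: pval_ge0.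
by apply: pval_ge0 => //; exact: (OK_int _ p%:Z).
Qed.

End PrimeIdeals.

(** * Heights of integers *)

Section Counting.
Variables (R : realType) (T : choiceType).
Local Open Scope ereal_scope.

Lemma counting_seq (r : seq T) : uniq r -> counting [set` r] = (size r)%:R%:E :> \bar R.
Proof.
move=> ur; have fr : finite_set [set` r] by exact: finite_seq.
rewrite /counting asboolT //; congr (_%:R%:E); apply/perm_size/uniq_perm => // y.
by rewrite in_fset_set // mem_setE.
Qed.

Lemma counting_nonneg (A : set T) : 0 <= counting A :> \bar R.
Proof. by rewrite /counting; case: ifP; rewrite ?lee_fin ?leey. Qed.

(** Take the largest fibre; an infinite [A] has an infinite one. *)
Lemma counting_pigeonhole (U : finType) (u0 : U) (f : T -> U) (A : set T) : exists u,
  counting A <= #|U|%:R%:E * counting (A `&` [set y | f y = u]) :> \bar R.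
Proof.
have [fA|nfA] := pselect (finite_set A); last first.
  have [u nfu] : exists u, ~ finite_set (A `&` [set y | f y = u]).
    apply/existsNP => fin; apply: nfA.
    rewrite (_ : A = \bigcup_(u in [set: U]) (A `&` [set y | f y = u])).
      by apply: bigcup_finite => // ; exact: finite_finset.
    by apply/seteqP; split=> [y Ay|y [u _ []]//]; exists (f y).
  (* [U] has positive cardinal, so the product with +oo is +oo and not 0. *)
  exists u; rewrite {2}/counting asboolF // mulry gtr0_sg ?mul1e ?leey //.
  by rewrite ltr0n; apply/card_gt0P; exists u0.
have [r ur ->] : exists2 r : seq T, uniq r & A = [set` r].
  have [r ->] := (finite_seqP A).1 fA; exists (undup r); rewrite ?undup_uniq //.
  by apply/seteqP; split=> y; rewrite /= mem_undup.
pose g u := size [seq y <- r | f y == u].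
have [u _ umax] := @arg_maxnP _ u0 xpredT g isT.
exists u; rewrite (_ : [set` r] `&` _ = [set` [seq y <- r | f y == u]]); last first.
  apply/seteqP; split=> y /=; rewrite mem_filter; last by move=> /andP[/eqP].
  by move=> [-> ->]; rewrite eqxx.
rewrite !counting_seq ?filter_uniq // -EFinM lee_fin -natrM ler_nat -/(g u).
rewrite -sum1_size (partition_big f xpredT) //= -sum_nat_const; apply: leq_sum => j _.
by apply: leq_trans (umax j isT); rewrite /g -sum1_size big_filter.
Qed.

End Counting.

Section HeightFormula.
Variables (R : realType) (K : fieldExtType rat).
Local Notation fac v y := (Num.max 1 (v y ^+ local_degree v) : R).

(** Conjugate embeddings induce one place, so [unit_rank_ge] bounds the number of places. One place
    [w] is split off: only the others are to be controlled by cells. *)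
Lemma arch_places_seq : exists (w : K -> R) (t : seq (K -> R)),
  [/\ uniq (w :: t), (size t <= unit_rank K)%N
    & forall v, v \in w :: t <-> arch_place v].
Proof.
have [n [s [x sx]]] := embedding_system_exists K (R[i] : numClosedFieldType).
have [c [cK cE]] := conj_embedding sx.
have [_ _ cpl _ _] := sx.
pose nu i : K -> R := fun y => normc (s i y).
pose Reps : {set 'I_n.+1} := [set conj_rep c i | i : 'I_n.+1].
pose V := undup [seq nu i | i <- enum Reps].
have VP v : v \in V <-> arch_place v.
  rewrite mem_undup; split=> [/mapP[i _ ->]|[t ->]]; first by exists (s i).
  have [i ti] := cpl t; apply/mapP; exists (conj_rep c i).
    by rewrite mem_enum; exact: imset_f.
  apply/funext => y; rewrite /nu ti /conj_rep; case: ifP => // _.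
  by rewrite cE normc_conj.
have sV : (size V <= (unit_rank K).+1)%N.
  apply: leq_trans (size_undup _) _; rewrite size_map -cardE.
  exact: (unit_rank_ge sx cK cE).
have : nu ord0 \in V by apply/VP; exists (s ord0).
have : uniq V by exact: undup_uniq.
by case: V VP sV => // w t VP sV uV _; exists w, t.
Qed.

Lemma arch_place_ge0 (v : K -> R) y : arch_place v -> 0 <= v y.
Proof. by move=> [t ->]; exact: normc_ge0. Qed.

Lemma arch_placeD (v : K -> R) y z : arch_place v -> v (y + z) <= v y + v z.
Proof. by move=> [t ->]; rewrite rmorphD normcD. Qed.

(** At a nonarchimedean place an integer has absolute value at most 1, so the factor there is 1. *)
Lemma height_integral (V : seq (K -> R)) y : uniq V ->
  (forall v, v \in V <-> arch_place v) -> OK y ->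
  height R y = \prod_(v <- V) fac v y.
Proof.
move=> uV VP Oy; rewrite /height [RHS]fsbig_seq //; apply/esym/fsbig_widen.
  by move=> v /= /VP; left.
move=> v [[av|nv] nV]; first by case: nV; apply/VP.
apply/max_idPl; apply: exprn_ile1; last exact: nonarch_place_le1.
have [P [p [_ _ _ ->]]] := nv; by rewrite /padic_abs; case: ifP.
Qed.

Lemma fac_ge1 (v : K -> R) y : 1 <= fac v y.
Proof. by rewrite le_max lexx. Qed.

(** By the triangle inequality the sum is at most twice the larger term in absolute value. *)
Lemma facD (v : K -> R) y z : arch_place v ->
  fac v (y + z) <= 2 ^+ local_degree v * Num.max (fac v y) (fac v z).
Proof.
move=> av; set d := local_degree v.
have le1 : 1 <= 2 ^+ d :> R by rewrite exprn_ege1 // ler1n.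
wlog yz : y z / v z <= v y.
  move=> G; case: (leP (v z) (v y)) => [|/ltW] zy; first exact: G.
  by rewrite addrC [X in _ <= _ * X]maxC; exact: G.
rewrite ge_max; apply/andP; split.
  by rewrite -[leLHS]mulr1 ler_pM ?ler01 // le_max fac_ge1.
apply: (@le_trans _ _ ((2 * v y) ^+ d)).
  rewrite lerXn2r ?nnegrE ?mulr_ge0 ?arch_place_ge0 //.
  by apply: le_trans (arch_placeD _ _ av) _; rewrite mulr_natl mulr2n lerD.
by rewrite exprMn ler_pM2l ?exprn_gt0 // !le_max lexx orbT.
Qed.

End HeightFormula.

(** * Cells and choice of the subset *)

Theorem proposition3p1 (R : realType) (K : fieldExtType rat) :
  exists b B : R, 0 < b /\ 0 < B /\
    forall H : R, 2 <= H ->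
    forall A : set K, A `<=` [set alpha | OK alpha /\ height R alpha <= H] ->
    exists A' : set K, A' `<=` A /\
      ((b / ln H ^+ unit_rank K)%:E * counting A <= counting A')%E /\
      forall alpha beta, A' alpha -> A' beta ->
        height R (alpha + beta) <= B * (height R alpha + height R beta).
Proof.
have [w [t [uV st VP]]] := arch_places_seq R K.
pose X (v : K -> R) y : R := Num.max 1 (v y ^+ local_degree v).
have X1 v y : 1 <= X v y by exact: fac_ge1.
have X0 v y : 0 < X v y by exact: lt_le_trans ltr01 (X1 v y).
have hE y : OK y -> height R y = \prod_(v <- w :: t) X v y by exact: height_integral.
(* Chosen so that L + 1 <= c0 ln H: L is at most ln H, and 1 is at most ln H / ln 2. *)
pose c0 : R := 1 + (ln 2)^-1.
have ln20 : 0 < ln 2 :> R by rewrite ln_gt0 // ltr1n.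
have c01 : 1 <= c0 by rewrite /c0 lerDl invr_ge0 ltW.
have c00 : 0 < c0 by exact: lt_le_trans ltr01 c01.
(* Powers of 2 come from [facD] at every place, and a factor e from the width of the cells at each
   place of [t]. *)
pose B : R := (\prod_(v <- w :: t) 2 ^+ local_degree v) * \prod_(v <- t) expR 1.
exists (c0 ^- unit_rank K), B; split; first by rewrite invr_gt0 exprn_gt0.
have B0 : 0 < B.
  by rewrite mulr_gt0 // prodr_gt0 // => v _; rewrite ?exprn_gt0 ?expR_gt0.
split=> // H H2 A AH.
have lnH : ln 2 <= ln H by rewrite ler_ln ?posrE // (lt_le_trans _ H2).
have lnH0 : 0 < ln H by exact: lt_le_trans lnH.
pose L := Num.truncn (ln H).
pose cells : finType := {ffun 'I_(size t) -> 'I_L.+1}.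
pose f y : cells := [ffun j => inord (Num.truncn (ln (X (nth w t (nat_of_ord j)) y)))].
have [u Au] := counting_pigeonhole R [ffun=> ord0] f A.
exists (A `&` [set y | f y = u]); split; first exact: subIsetl.
set A' := A `&` _ in Au *; set r := unit_rank K in st *; split.
  apply: (@le_trans _ _
    ((c0 ^- r / ln H ^+ r)%:E * (#|cells|%:R%:E * counting A'))%E).
    by apply: lee_wpmul2l => //; rewrite lee_fin divr_ge0 ?invr_ge0 ?exprn_ge0 ?ltW.
  rewrite muleA -EFinM -[leRHS]mul1e; apply: lee_wpmul2r; first exact: counting_nonneg.
  rewrite lee_fin card_ffun !card_ord -invfM -exprMn mulrC ler_pdivrMr; last first.
    by rewrite exprn_gt0 // mulr_gt0.
  rewrite mul1r natrX.
  have L1 : L.+1%:R <= c0 * ln H.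
    rewrite mulrDl mul1r -natr1 lerD //; first by rewrite truncn_le ltW.
    by rewrite mulrC ler_pdivlMr // mul1r.
  (* The exponent can grow from [size t] to [r] because c0 ln H >= L + 1 >= 1. *)
  apply: (@le_trans _ _ ((c0 * ln H) ^+ size t)); first last.
    by rewrite ler_weXn2l // (le_trans _ L1) // ler1n.
  by apply: lerXn2r => //; rewrite nnegrE // mulr_ge0 // ltW.
(* One factor is at most the whole product, the others being at least 1; so [inord] in [f] stays
   within range. *)
have ftrunc y v : A y -> v \in t -> (Num.truncn (ln (X v y)) <= L)%N.
  move=> /AH[Oy hy] vt; apply: le_truncn; rewrite ler_ln ?posrE //; last first.
    by rewrite (lt_le_trans _ H2).
  apply: le_trans hy; rewrite hE // (big_rem v) /=; last by rewrite inE vt orbT.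
  apply: ler_peMr; first exact: ltW.
  elim/big_ind: _ => // a a' a1 a'1.
  by rewrite -[1]mulr1 ler_pM.
(* Equal integer parts leave the logarithms less than 1 apart. *)
have near y z v : A y -> A z -> f y = f z -> v \in t -> X v y <= expR 1 * X v z.
  move=> Ay Az fyz vt; rewrite -ler_ln ?posrE ?mulr_gt0 ?expR_gt0 //.
  rewrite lnM ?posrE ?expR_gt0 // expRK.
  have vi : (index v t < size t)%N by rewrite index_mem.
  have := congr1 (fun g : cells => nat_of_ord (g (Ordinal vi))) fyz.
  rewrite !ffunE /= !nth_index // !inordK ?ltnS ?ftrunc // => E.
  have /andP[_ y2] := truncn_itv (ln_ge0 (X1 v y)).
  have /andP[z1 _] := truncn_itv (ln_ge0 (X1 v z)).
  by move: y2; rewrite E -natr1; lra.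
(* The cells do not constrain [w]; [y] is taken to be the element with the larger factor there. *)
move=> y z; wlog yz : y z / X w z <= X w y.
  move=> G Ay Az; case: (leP (X w z) (X w y)) => [|/ltW] wz; first exact: G.
  by rewrite addrC [X in _ <= _ * X]addrC; exact: G.
move=> [Ay fy] [Az fz]; have [Oy _] := AH _ Ay; have [Oz _] := AH _ Az.
have archV v : v \in w :: t -> arch_place v by move/VP.
apply: (@le_trans _ _ (B * height R y)); last first.
  rewrite ler_pM2l // lerDl hE // prodr_ge0 // => v _; exact: ltW.
rewrite !hE //; last exact: OKD.
have -> : B * \prod_(v <- w :: t) X v y =
    (2 ^+ local_degree w * X w y) * \prod_(v <- t) (2 ^+ local_degree v * (expR 1 * X v y)).
  rewrite !big_split /= /B !big_cons -[X in X * _ = _]mulrA mulrACA.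
  by congr (_ * _); rewrite mulrA.
rewrite big_cons; apply: ler_pM; first exact: ltW.
- by apply: prodr_ge0 => v _; exact: ltW.
- apply: le_trans (facD _ _ _) _; first by apply: archV; rewrite mem_head.
  by rewrite ler_pM2l ?exprn_gt0 // ge_max lexx.
rewrite !big_seq; apply: ler_prod => v vt; rewrite ltW //=.
apply: le_trans (facD _ _ _) _; first by apply: archV; rewrite inE vt orbT.
rewrite ler_pM2l ?exprn_gt0 // ge_max; apply/andP; split; last first.
  by apply: near => //; exact: etrans fz (esym fy).
by apply: ler_peMl; [exact/ltW/X0 | rewrite -[leLHS]expR0 ler_expR].
Qed.
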